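(* For all integers $1\le s\le k\le n$, $p\ge1$ and $r\ge0$, $$\sum_{j=s}^n\frac{2ps}{(2p-1)j+s}\binom{2pj-1}{j-s}\,\frac{(p-1)(n-j)+r+k-s+1}{p(n-j)+r+1}\binom{2\big(p(n-j)+r+1\big)}{n-j-k+s}=\frac{(p-1)n+r+k+1}{pn+r+1}\binom{2(pn+r+1)}{n-k}.$$
   Context: Binomial coefficients $\binom{a}{b}$ with $b<0$ are equal to $0$. *)

(* Defs.v *)
From mathcomp Require Import all_boot all_order all_algebra.

Set Implicit Arguments.
Unset Strict Implicit.
Unset Printing Implicit Defensive.

Import GRing.Theory.
Local Open Scope ring_scope.

(* The lower index is an integer because in n - j - k + s it can be negative,
   where truncated subtraction on nat would give 'C(a, 0) = 1 instead of 0. *)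
Definition binz (a : nat) (b : int) : nat :=
  if b is Posz m then 'C(a, m) else 0%N.

(* Main.v *)
Require Import Defs.
From mathcomp Require Import all_boot all_order all_algebra.
From mathcomp Require Import zify ring.

Set Implicit Arguments.
Unset Strict Implicit.
Unset Printing Implicit Defensive.

Import GRing.Theory.
Local Open Scope ring_scope.

(** With [w = z (1 + w) ^ b], Lagrange inversion identifies the first factor
    of the summand as the coefficient of [z ^ j] in [w ^ s] (where [b = 2 p]);
    up to a shift it is a Rothe number [x / (x + b i) * 'C(x + b i, i)] with
    [x = b s] and [i = j - s].  The second factor, with [h = p (n - j) + r + 1],
    is the ballot difference ['C(2 h - 1, t) - 'C(2 h - 1, t - 1)].  So the sum
    is a difference of two instances of the Rothe-Hagen convolution
    [\sum_i rothe b x i * 'C(y - b i, M - i) = 'C(x + y, M)], which follows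
    by induction from the recurrence
    [rothe b (x + 1) (i + 1) = rothe b x (i + 1) + rothe b (x + b) i],
    the coefficient form of [(1 + w) ^ (x + 1) = (1 + w) ^ x + w (1 + w) ^ x]. *)

(* The division-free form of x / (x + b i) * 'C(x + b i, i); unlike the
   quotient, it has the right value 1 at x = i = 0. *)
Definition rothe (b x i : nat) : rat :=
  'C(x + b * i, i)%:R -
  b%:R * (if i is i'.+1 then 'C((x + b * i).-1, i') else 0)%:R.

Lemma rothe0 (b x : nat) : rothe b x 0 = 1.
Proof. by rewrite /rothe bin0 mulr0 subr0. Qed.

Lemma rothe0S (b i : nat) : (0 < b)%N -> rothe b 0 i.+1 = 0.
Proof.
move=> b0; rewrite /rothe add0n; apply/eqP; rewrite subr_eq0; apply/eqP.
rewrite -natrM; congr (_%:R); apply/eqP.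
rewrite -(eqn_pmul2l (ltn0Sn i)) -mul_bin_diag; apply/eqP.
by rewrite mulnA (mulnC b).
Qed.

Lemma rotheS (b x i : nat) : (0 < b)%N ->
  rothe b x.+1 i.+1 = rothe b x i.+1 + rothe b (x + b) i.
Proof.
case: b => [//|b] _; rewrite /rothe.
have -> : (x.+1 + b.+1 * i.+1)%N = (x + b + b.+1 * i).+2 by lia.
have -> : (x + b.+1 * i.+1)%N = (x + b + b.+1 * i).+1 by lia.
have -> : (x + b.+1 + b.+1 * i)%N = (x + b + b.+1 * i).+1 by lia.
set N := (x + b + _)%N; rewrite !succnK (binS N.+1 i) natrD.
by case: i @N => [|i] N; rewrite ?bin0 ?(binS N i) ?natrD; ring.
Qed.

(** With [x = 2 * p * s], [b = 2 * p] and [i = j - s], the denominator [D] satisfies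
    [D + i = x + b * i]; multiplying by [D] leaves absorption identities for binomials. *)
Lemma rotheE (p s j : nat) : (0 < p)%N -> (0 < s)%N -> (s <= j)%N ->
  (2 * p%:R * s%:R) / ((2 * p%:R - 1) * j%:R + s%:R)
    * 'C(2 * p * j - 1, j - s)%:R = rothe (2 * p) (2 * p * s) (j - s).
Proof.
case: p => [//|p] _ s0 sj.
have [i ->] : exists i, j = (s + i)%N by exists (j - s)%N; lia.
have -> : (s + i - s)%N = i by lia.
have -> : (2 * p.+1%:R - 1) * (s + i)%:R + s%:R
          = (2 * p.+1 * s + (2 * p).+1 * i)%N%:R :> rat.
  by ring.
set D := (2 * p.+1 * s + _)%N.
have D0 : D%:R != 0 :> rat by rewrite Num.Theory.pnatr_eq0 /D; lia.
apply: (mulfI D0); rewrite -mulrA mulrCA mulVKf //.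
rewrite /rothe.
have -> : (2 * p.+1 * s + 2 * p.+1 * i)%N = (D + i)%N by rewrite /D; lia.
have -> : (2 * p.+1 * (s + i) - 1)%N = (D + i).-1 by rewrite /D; lia.
have Dbs : (D + i)%:R = (2 * p.+1)%:R * s%:R + (2 * p.+1)%:R * i%:R :> rat.
  by rewrite -!natrM -natrD /D; congr (_%:R); lia.
have E1 := mul_bin_down (D + i) i; rewrite addnK in E1.
clearbody D; rewrite mulrBr -[D%:R * _%:R]natrM -E1 natrM Dbs.
case: i E1 Dbs => [|i] _ _; first by rewrite !mulr0; ring.
have E2 := mul_bin_left (D + i.+1).-1 i.
rewrite (_ : (D + i.+1).-1 - i = D)%N in E2; last by lia.
by rewrite [D%:R * (_ * _)]mulrCA -!natrM -E2 !natrM; ring.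
Qed.

Lemma binzS (a : nat) (z : int) :
  binz a.+1 z = (binz a z + binz a (z - 1))%N.
Proof.
case: z => [[|m]|m] //; first by rewrite /= !bin0.
by have -> : Posz m.+1 - 1 = m by lia.
Qed.

(** The bound on [y] prevents truncation in [y - b * i], and [M < L] puts every nonzero term in
    range. *)
Theorem rothe_hagen (b x y L : nat) (M : int) :
  (0 < b)%N -> (b * L.-1 <= y)%N -> (M < L%:Z)%R ->
  \sum_(i < L) rothe b x i * (binz (y - b * i) (M - i%:Z))%:R
  = (binz (x + y) M)%:R.
Proof.
move=> b0; elim: L => [|L IHL] in x y M *.
  by move=> _; case: M => // m _; rewrite big_ord0.
move=> /= Ly ML; elim: x => [|x IHx].
  rewrite big_ord_recl big1 => [|i _]; last by rewrite rothe0S // mul0r.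
  by rewrite rothe0 muln0 subn0 subr0 mul1r addr0.
rewrite addSn binzS natrD -IHx !big_ord_recl !rothe0 -addrA; congr (_ + _).
(* With a single summand [b <= y] may fail, but then [M - 1 < 0] and the second Pascal term
   vanishes. *)
case: L {IHx} => [|L] in IHL Ly ML *.
  by rewrite !big_ord0 add0r; case: M ML {IHL} => [[|m]|m] //; lia.
(* The second Pascal term is the shorter convolution at [x + b], [y - b], [M - 1]. *)
have yE : (x + y = x + b + (y - b))%N by lia.
rewrite yE -IHL; [|lia..].
rewrite -big_split; apply: eq_bigr => i _ /=.
rewrite /bump !add1n rotheS // mulrDl mulnS subnDA.
by have -> : M - i.+1%:Z = M - 1 - i%:Z by lia.
Qed.

(** Splitting [2 * (h - t)] as [(2 * h - t) - t], each part is absorbed by the binomial. *)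
Lemma ballot_binz (h : nat) (t : int) : (0 < h)%N ->
  (h%:R - t%:~R) / h%:R * (binz (2 * h) t)%:R
  = (binz (2 * h).-1 t)%:R - (binz (2 * h).-1 (t - 1))%:R :> rat.
Proof.
move=> h0.
have h0r : h%:R != 0 :> rat by rewrite Num.Theory.pnatr_eq0; lia.
have h20 : (2 * h)%:R != 0 :> rat by rewrite Num.Theory.pnatr_eq0; lia.
case: t => [m|m]; last by rewrite !mulr0 subrr.
apply: (mulfI h20).
have -> : (2 * h)%:R * ((h%:R - m%:~R) / h%:R * 'C(2 * h, m)%:R)
       = ((2 * h)%:R - m%:R - m%:R) * 'C(2 * h, m)%:R :> rat.
  by rewrite natrM; field.
have -> : ((2 * h)%:R - m%:R - m%:R) * 'C(2 * h, m)%:R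
       = (2 * h - m)%:R * 'C(2 * h, m)%:R - m%:R * 'C(2 * h, m)%:R :> rat.
  (* If [2 * h < m], the subtraction truncates but the binomial is zero. *)
  case: (leqP m (2 * h)) => mh; first by rewrite mulrBl natrB.
  by rewrite bin_small // !mulr0 subr0.
rewrite mulrBr -!natrM -mul_bin_down; congr (_ - _%:R).
case: m => [|m]; first by rewrite muln0.
by rewrite (_ : Posz m.+1 - 1 = m) ?mul_bin_diag //; lia.
Qed.

Theorem mainTheorem3 (n k s p r : nat)
    (hs : (1 <= s)%N) (hsk : (s <= k)%N) (hkn : (k <= n)%N) (hp : (1 <= p)%N) :
  \sum_(s <= j < n.+1)
     ((2 * p%:R * s%:R) / ((2 * p%:R - 1) * j%:R + s%:R)
      * (binz (2 * p * j - 1)%N (j%:Z - s%:Z))%:R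
      * (((p%:R - 1) * (n%:R - j%:R) + r%:R + k%:R - s%:R + 1)
         / (p%:R * (n%:R - j%:R) + r%:R + 1))
      * (binz (2 * (p * (n - j) + r + 1))%N (n%:Z - j%:Z - k%:Z + s%:Z))%:R)
  = ((p%:R - 1) * n%:R + r%:R + k%:R + 1) / (p%:R * n%:R + r%:R + 1)
    * (binz (2 * (p * n + r + 1))%N (n%:Z - k%:Z))%:R :> rat.
Proof.
have pnr (m : nat) : p%:R * m%:R + r%:R + 1 = (p * m + r + 1)%:R :> rat.
  by rewrite !natrD natrM.
have -> : (p%:R - 1) * n%:R + r%:R + k%:R + 1
        = (p * n + r + 1)%:R - (n%:Z - k%:Z)%:~R :> rat.
  by rewrite -pnr intrB; ring.
rewrite pnr ballot_binz; last by lia.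
(* Split as [x + y] so that [y - 2 * p * (j - s)] is [2 * h - 1] for the [h] of the [j]-th
   summand. *)
have -> : (2 * (p * n + r + 1)).-1
        = (2 * p * s + (2 * p * (n - s) + 2 * r + 1))%N by nia.
rewrite -!(@rothe_hagen (2 * p) _ _ (n - s).+1); [|lia..].
rewrite -sumrB -{1}[s]add0n big_addn big_mkord subSn ?(leq_trans hsk) //.
apply: eq_bigr => i _; have /ltnSE li := ltn_ord i.
rewrite -mulrBr -[in RHS](addnK s i) -rotheE ?leq_addl // -!mulrA.
have -> : (i + s)%:Z - s%:Z = (i + s - s)%N by lia.
do 5!congr (_ * _).
have -> : n%:R - (i + s)%:R = (n - (i + s))%:R :> rat by rewrite natrB //; lia.
rewrite pnr.
set m := (n - (i + s))%N.
set t := n%:Z - (i + s)%:Z - k%:Z + s%:Z.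
have -> : (p%:R - 1) * m%:R + r%:R + k%:R - s%:R + 1
        = (p * m + r + 1)%:R - t%:~R :> rat.
  have -> : t = m%:Z - k%:Z + s%:Z by rewrite /t /m; lia.
  by rewrite -pnr intrD intrB; ring.
rewrite mulrA ballot_binz; last by lia.
rewrite addnK.
by congr ((binz _ _)%:R - (binz _ _)%:R); rewrite /t /m; nia.
Qed.
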